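(* Let $p=2$ and consider a lasso with normalized data. The point of tangency of the ellipse and the square giving the lasso solution cannot belong to the interior of more than one edge of the square as $t$ varies; that is, the points $\beta(t)$, $0<t<\hat t$, with both coordinates nonzero all lie in the interior of a single quadrant of $\mathbb R^2$ (if there are any).
   Context: For $p=2$, a data set consists of $N$ points $(x_1^{(i)},x_2^{(i)},y^{(i)})\in\mathbb R^{3}$ with centroid at the origin and not contained in any proper affine subspace (full rank assumption). Put $K=\frac1N\sum_i x^{(i)}(x^{(i)})^T$ (positive definite), $b=\frac1N\sum_i y^{(i)}x^{(i)}$, $\hat\beta=K^{-1}b$, $\hat t=|\hat\beta_1|+|\hat\beta_2|$. The data are normalized if $K_{11}=K_{22}=1$. For $t\ge0$ the lasso estimate $\beta(t)$ is the unique minimizer of $f(\beta)=\frac12\sum_i\big(y^{(i)}-\beta_1x_1^{(i)}-\beta_2x_2^{(i)}\big)^2$ over $\beta\in\mathbb R^2$ with $|\beta_1|+|\beta_2|\le t$. For $0<t<\hat t$ it is the point of tangency of the square $\{|\beta_1|+|\beta_2|=t\}$ with an ellipse from the homothetic family $\langle K(\beta-\hat\beta),\beta-\hat\beta\rangle=\text{const}$. As $t$ varies, an edge of the square is identified by the quadrant containing it. *)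

(* Defs.v *)
From mathcomp Require Import all_boot all_order all_algebra.
From mathcomp Require Import reals.

Set Implicit Arguments.
Unset Strict Implicit.
Unset Printing Implicit Defensive.

Import Order.TTheory GRing.Theory Num.Theory.
Local Open Scope ring_scope.

Section Lasso.
Variables (R : realType) (p N : nat).
Variables (x : 'I_N -> 'cV[R]_p) (y : 'I_N -> R).

Definition data_point (i : 'I_N) : 'cV[R]_(p + 1) := col_mx (x i) (y i)%:M.

Definition centered : Prop := N%:R^-1 *: \sum_i data_point i = 0.

(* An affine subspace is a translate [q + U]; the empty one needs no separate
   treatment, since for [N = 0] the choice [U = 0] already violates the
   condition. *)
Definition full_rank : Prop :=
  forall (q : 'cV[R]_(p + 1)) (U : {vspace 'cV[R]_(p + 1)}),
    (forall i, data_point i - q \in U) -> U = fullv.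

Definition data_set : Prop := centered /\ full_rank.

Definition covK : 'M[R]_p := N%:R^-1 *: \sum_i (x i *m (x i)^T).

Definition covb : 'cV[R]_p := N%:R^-1 *: \sum_i (y i *: x i).

Definition normalized : Prop := forall j, covK j j = 1.

Definition l1norm (beta : 'cV[R]_p) : R := \sum_j `|beta j 0|.

Definition beta_hat : 'cV[R]_p := invmx covK *m covb.

Definition t_hat : R := l1norm beta_hat.

Definition lasso_loss (beta : 'cV[R]_p) : R :=
  2^-1 * \sum_i (y i - \sum_j beta j 0 * x i j 0) ^+ 2.

(* For a full-rank data set [covK] is positive definite, so for each [t >= 0]
   exactly one [beta] satisfies this predicate. *)
Definition lasso_estimate (t : R) (beta : 'cV[R]_p) : Prop :=
  l1norm beta <= t /\
  forall gamma : 'cV[R]_p, l1norm gamma <= t ->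
    lasso_loss beta <= lasso_loss gamma.

End Lasso.

(* Open orthants (quadrants for [p = 2]) are indexed by sign patterns, where
   [s j = true] means that the [j]-th coordinate is negative. *)
Definition orthant_interior (R : realType) (p : nat) (s : {ffun 'I_p -> bool})
    (beta : 'cV[R]_p) : Prop :=
  forall j, 0 < (-1) ^+ s j * beta j 0.

(* The relative interior of the face of [{l1norm = t}], [t > 0], lying in the
   orthant [s]; for [p = 2] this is an edge of the square without its two
   end points. *)
Definition edge_interior (R : realType) (p : nat) (s : {ffun 'I_p -> bool})
    (t : R) (beta : 'cV[R]_p) : Prop :=
  l1norm beta = t /\ orthant_interior s beta.

(* Main.v *)
(** At a tangency point [beta] inside an edge with sign vector [sigma], the
    first-order condition reads [b - K beta = lambda sigma] with
    [lambda >= 0]. For normalized data and [p = 2], every sign vector is an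
    eigenvector of [K], so [beta_hat = beta + mu sigma] with [mu >= 0]: the
    edge lies in the open quadrant containing [beta_hat]. *)

Require Import Defs.
From mathcomp Require Import all_boot all_order all_algebra.
From mathcomp Require Import reals.
From mathcomp Require Import ring lra.

Set Implicit Arguments.
Unset Strict Implicit.
Unset Printing Implicit Defensive.

Import Order.TTheory GRing.Theory Num.Theory.
Local Open Scope ring_scope.

(** * Sign patterns and the l1 norm near a point of an open orthant *)

Section Orthants.
Variables (R : realType) (p : nat).
Implicit Types (beta d : 'cV[R]_p) (s : {ffun 'I_p -> bool}).

Lemma orthant_interior_inj s1 s2 beta :
  orthant_interior s1 beta -> orthant_interior s2 beta -> s1 = s2.
Proof.
move=> h1 h2; apply/ffunP => j; move: (h1 j) (h2 j).
by case: (s1 j) (s2 j) => [] []; rewrite ?expr1 ?expr0 => // ? ?; lra.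
Qed.

Lemma orthant_interior_ltr0 beta :
  (forall j, beta j 0 != 0) -> orthant_interior [ffun j => beta j 0 < 0] beta.
Proof.
move=> beta0 j; rewrite ffunE.
by have [h|h|/eqP h] := ltrgt0P (beta j 0); rewrite ?expr0 ?expr1 ?mul1r ?mulN1r ?oppr_gt0 // (negPf (beta0 j)) in h *.
Qed.

Lemma l1norm_orthant s beta :
  (forall j, 0 <= (-1) ^+ s j * beta j 0) ->
  l1norm beta = \sum_j (-1) ^+ s j * beta j 0.
Proof.
move=> h; apply: eq_bigr => j _.
by rewrite -[RHS]ger0_norm ?h // normrMsign.
Qed.

(** The bound on [e] keeps [beta + e *: d] in the closed orthant of [s]. There the l1 norm is the
    linear form with coefficients [(-1) ^+ s j], which does not increase along [d]. *)
Lemma l1norm_descent s beta d (e : R) :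
  orthant_interior s beta -> 0 <= e ->
  (forall j, e * `|d j 0| <= `|beta j 0|) ->
  \sum_j (-1) ^+ s j * d j 0 <= 0 ->
  l1norm (beta + e *: d) <= l1norm beta.
Proof.
move=> hs e0 small hd.
rewrite (@l1norm_orthant s beta); last by move=> j; exact/ltW.
rewrite (@l1norm_orthant s) => [|j]; last first.
  have hb : (-1) ^+ s j * beta j 0 = `|beta j 0|.
    by rewrite -(normrMsign (s j)) ger0_norm // ltW.
  rewrite !mxE mulrDr hb.
  apply: (@le_trans _ _ (`|beta j 0| - e * `|d j 0|)); first by rewrite subr_ge0.
  rewrite lerD2l mulrCA -mulrN ler_wpM2l //.
  by rewrite -(normrMsign (s j) (d j 0)) lerNl -normrN ler_norm.
rewrite -subr_ge0 -sumrB.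
under eq_bigr do rewrite !mxE mulrDr opprD addrA subrr add0r mulrCA.
by rewrite sumrN oppr_ge0 -mulr_sumr mulr_ge0_le0.
Qed.

End Orthants.

(** * First-order conditions for the lasso estimate *)

Section LassoStationarity.
Variables (R : realType) (p N : nat).
Variables (x : 'I_N -> 'cV[R]_p) (y : 'I_N -> R).
Implicit Types (beta d : 'cV[R]_p) (s : {ffun 'I_p -> bool}).

(** This is the gradient of [lasso_loss] at [beta] divided by [- N]. *)
Definition residual_corr beta : 'cV[R]_p := covb x y - covK x *m beta.

Lemma residual_corrE beta j :
  residual_corr beta j 0 =
  N%:R^-1 * \sum_i x i j 0 * (y i - \sum_k beta k 0 * x i k 0).
Proof.
rewrite /residual_corr /covb /covK -scalemxAl mulmx_suml -scalerBr -sumrB.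
rewrite mxE summxE; congr (_ * _); apply: eq_bigr => i _.
rewrite !mxE mulrBr mulrC; congr (_ - _).
rewrite mulr_sumr; apply: eq_bigr => k _.
by rewrite !mxE big_ord1 !mxE -mulrA [beta k 0 * _]mulrC.
Qed.

(** The loss is quadratic, so its second-order Taylor expansion is exact; this replaces derivatives
    below. *)
Lemma lasso_loss_shift beta d (e : R) : (0 < N)%N ->
  lasso_loss x y (beta + e *: d) = lasso_loss x y beta
    - e * N%:R * \sum_j d j 0 * residual_corr beta j 0
    + e ^+ 2 * (2^-1 * \sum_i (\sum_j d j 0 * x i j 0) ^+ 2).
Proof.
move=> N0.
have -> : \sum_j d j 0 * residual_corr beta j 0 = N%:R^-1 *
    \sum_i (\sum_j d j 0 * x i j 0) * (y i - \sum_k beta k 0 * x i k 0).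
  under eq_bigr do rewrite residual_corrE mulrCA mulr_sumr.
  rewrite -mulr_sumr exchange_big /=; congr (_ * _); apply: eq_bigr => i _.
  by rewrite mulr_suml; apply: eq_bigr => j _; rewrite mulrA.
rewrite -mulrA mulVKf ?pnatr_eq0 -?lt0n //.
rewrite /lasso_loss !mulr_sumr -sumrB -big_split /=; apply: eq_bigr => i _.
have -> : \sum_j (beta + e *: d) j 0 * x i j 0 =
    \sum_j beta j 0 * x i j 0 + e * \sum_j d j 0 * x i j 0.
  rewrite mulr_sumr -big_split; apply: eq_bigr => j _ /=.
  by rewrite !mxE mulrDl mulrA.
by field.
Qed.

(** Otherwise a short step along [d] would stay in the l1 ball, while its linear gain in the loss
    outweighs the quadratic cost, against minimality. *)
Lemma lasso_first_order t beta s d : (0 < N)%N ->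
  lasso_estimate x y t beta -> orthant_interior s beta ->
  \sum_j (-1) ^+ s j * d j 0 <= 0 ->
  \sum_j d j 0 * residual_corr beta j 0 <= 0.
Proof.
move=> N0 [betat betamin] hs hd; rewrite leNgt; apply/negP => g0.
set g := \sum_j _ in g0.
set q := 2^-1 * \sum_i (\sum_j d j 0 * x i j 0) ^+ 2.
have q0 : 0 <= q by rewrite mulr_ge0 ?invr_ge0 ?sumr_ge0 // => i _; exact: sqr_ge0.
have N0' : 0 < N%:R :> R by rewrite ltr0n.
have Ng : 0 < N%:R * g by rewrite mulr_gt0.
have beta_gt0 j : 0 < `|beta j 0|.
  by rewrite -(normrMsign (s j)) normr_gt0 gt_eqF.
(* The sum serves as an upper bound for every single ratio. *)
pose a := \sum_j `|d j 0| / `|beta j 0|.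
have a_ge j : `|d j 0| / `|beta j 0| <= a.
  rewrite /a (bigD1 j) //= lerDl sumr_ge0 // => k _.
  by rewrite divr_ge0.
have a0 : 0 <= a by rewrite sumr_ge0 // => j _; rewrite divr_ge0.
(* The step length will be [c^-1]: the term [a] keeps the step inside the orthant, the last term
   makes the linear gain dominate, and 1 makes the inequalities strict. *)
pose c := 1 + a + q / (N%:R * g).
have qg0 : 0 <= q / (N%:R * g) by rewrite divr_ge0 // ltW.
have c0 : 0 < c by rewrite /c; lra.
have small j : c^-1 * `|d j 0| <= `|beta j 0|.
  rewrite ler_pdivrMl // -ler_pdivrMr //.
  by apply: le_trans (a_ge j) _; rewrite /c; lra.
have iv0 : 0 < c^-1 by rewrite invr_gt0.
have := betamin _ (le_trans (l1norm_descent hs (ltW iv0) small hd) betat).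
rewrite lasso_loss_shift // -/g -/q; apply/negP; rewrite -ltNge.
have qc : q < c * (N%:R * g).
  by rewrite -ltr_pdivrMr // /c; lra.
have : c^-1 ^+ 2 * q < c^-1 * N%:R * g.
  by rewrite expr2 -!mulrA ltr_pM2l // ltr_pdivrMl.
lra.
Qed.

(** Testing the first-order condition along the face shows that the signed coordinates of the
    gradient agree; testing it inward gives the sign of their common value. *)
Lemma lasso_stationary t beta s : (0 < N)%N ->
  lasso_estimate x y t beta -> orthant_interior s beta ->
  exists2 lambda, 0 <= lambda &
    forall j, residual_corr beta j 0 = lambda * (-1) ^+ s j.
Proof.
move=> N0 est hs; set g := residual_corr beta.
have test (c : R) i (f : 'I_p -> R) :
    \sum_j (c *: delta_mx i 0 : 'cV[R]_p) j 0 * f j = c * f i.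
  rewrite (bigD1 i) //= !mxE !eqxx mulr1 big1 ?addr0 // => j /negPf ji.
  by rewrite !mxE ji mulr0 mul0r.
have signed i j : (-1) ^+ s i * g i 0 <= (-1) ^+ s j * g j 0.
  (* This direction is parallel to the face: its signed coordinates sum to [1 - 1 = 0], or [d] is 0
     when [i = j]. *)
  pose d : 'cV[R]_p :=
    (-1) ^+ s i *: delta_mx i 0 - (-1) ^+ s j *: delta_mx j 0.
  have testB (f : 'I_p -> R) :
      \sum_k d k 0 * f k = (-1) ^+ s i * f i - (-1) ^+ s j * f j.
    rewrite -!test -sumrB; apply: eq_bigr => k _.
    by rewrite -mulrBl /d mxE [X in _ + X]mxE.
  have := @lasso_first_order t beta s d N0 est hs.
  under eq_bigr do rewrite mulrC.
  by rewrite !testB -!expr2 !sqrr_sign subrr lexx subr_le0 => /(_ isT).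
have pos i : 0 <= (-1) ^+ s i * g i 0.
  (* This direction points into the ball: its signed sum is [-1]. *)
  have := @lasso_first_order t beta s (- (-1) ^+ s i *: delta_mx i 0) N0 est hs.
  under eq_bigr do rewrite mulrC.
  by rewrite !test mulNr -expr2 sqrr_sign mulNr !oppr_le0 ler01 => /(_ isT).
(* Any coordinate supplies [lambda]; for [p = 0] there is none and 0 works vacuously. *)
case: (pickP 'I_p) => [i _|no]; last by exists 0 => // j; have := no j.
exists ((-1) ^+ s i * g i 0) => // j.
have -> : (-1) ^+ s i * g i 0 = (-1) ^+ s j * g j 0.
  by apply/eqP; rewrite eq_le !signed.
by rewrite mulrAC -expr2 sqrr_sign mul1r.
Qed.

End LassoStationarity.

(** * Positive definiteness of the covariance matrix *)

Section Covariance.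
Variables (R : realType) (p N : nat).
Variables (x : 'I_N -> 'cV[R]_p) (y : 'I_N -> R).

Lemma covKE j k : covK x j k = N%:R^-1 * \sum_i x i j 0 * x i k 0.
Proof.
rewrite /covK mxE summxE; congr (_ * _); apply: eq_bigr => i _.
by rewrite mxE big_ord1 !mxE.
Qed.

Lemma covK_sym j k : covK x j k = covK x k j.
Proof.
by rewrite !covKE; congr (_ * _); apply: eq_bigr => i _; rewrite mulrC.
Qed.

Lemma covK_quadratic (c : 'cV[R]_p) :
  (c^T *m covK x *m c) 0 0 = N%:R^-1 * \sum_i (\sum_j c j 0 * x i j 0) ^+ 2.
Proof.
rewrite /covK -scalemxAr -scalemxAl mulmx_sumr mulmx_suml mxE summxE.
congr (_ * _); apply: eq_bigr => i _.
rewrite mulmxA -(mulmxA (c^T *m x i)) mxE big_ord1 expr2.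
by congr (_ * _); rewrite mxE; apply: eq_bigr => j _; rewrite !mxE // mulrC.
Qed.

Hypothesis fr : full_rank x y.

(** All data points lie in the kernel of the functional [(c, 0)]. Full rank makes this kernel the
    whole space, and evaluation at the basis vectors then reads off [c]. *)
Lemma full_rank_lin_comb (c : 'cV[R]_p) :
  (forall i, \sum_j c j 0 * x i j 0 = 0) -> c = 0.
Proof.
move=> hc.
pose w : 'rV[R]_(p + 1) := row_mx c^T 0.
pose f := linfun (mulmx w : 'cV[R]_(p + 1) -> 'M[R]_1).
have fullU : lker f = fullv.
  apply: (fr (q := 0)) => i; rewrite subr0 memv_ker lfunE /= mul_row_col mul0mx addr0.
  apply/eqP/matrixP => a b; rewrite !ord1 !mxE -[RHS](hc i).
  by apply: eq_bigr => j _; rewrite !mxE.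
apply/matrixP => j k; rewrite ord1 [RHS]mxE.
have : delta_mx (lshift 1 j) 0 \in lker f by rewrite fullU memvf.
rewrite memv_ker lfunE /= => /eqP/matrixP/(_ 0 0).
by rewrite -colE !mxE (unsplitK (inl _)) mxE.
Qed.

Lemma covK_posdef (c : 'cV[R]_p) :
  (0 < N)%N -> c != 0 -> 0 < (c^T *m covK x *m c) 0 0.
Proof.
move=> N0 c0; rewrite covK_quadratic mulr_gt0 ?invr_gt0 ?ltr0n //.
have nonneg i : true -> 0 <= (\sum_j c j 0 * x i j 0) ^+ 2 by rewrite sqr_ge0.
rewrite lt_neqAle sumr_ge0 // andbT; apply: contra c0 => /eqP/esym.
move=> /(psumr_eq0P nonneg) van; apply/eqP/full_rank_lin_comb => i.
by apply/eqP; rewrite -sqrf_eq0 van.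
Qed.

Lemma covK_unit : (0 < N)%N -> covK x \in unitmx.
Proof.
move=> N0; rewrite -row_free_unit; apply: inj_row_free => v vK.
apply: contraTeq isT => v0.
have := @covK_posdef v^T N0; rewrite trmxK vK mul0mx mxE ltxx.
by rewrite trmx_eq0 => /(_ v0).
Qed.

End Covariance.

(** * Normalized data in the plane *)

Section NormalizedPlane.
Variables (R : realType) (N : nat).
Variables (x : 'I_N -> 'cV[R]_2) (y : 'I_N -> R).
Hypotheses (fr : full_rank x y) (hnorm : normalized x).

Lemma normalized_data_gt0 : (0 < N)%N.
Proof.
(* For [N = 0] the convention [0^-1 = 0] would make the diagonal entry 0 instead of 1. *)
have := hnorm 0; rewrite covKE lt0n => h; apply/eqP => N0.
have : N%:R = 0 :> R by rewrite N0.
by move=> Nr0; move: h; rewrite Nr0 invr0 mul0r => /esym/eqP; rewrite oner_eq0.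
Qed.

Lemma sum_ord2 (F : 'I_2 -> R) : \sum_i F i = F 0 + F 1.
Proof.
by rewrite !big_ord_recl big_ord0 addr0; congr (_ + F _); exact/val_inj.
Qed.

(** The quadratic form of [covK x] at the vector [(1, e)] equals [2 * (1 + e * covK x 0 1)]. *)
Lemma covK_offdiag_bound (e : R) : e ^+ 2 = 1 -> 0 < 1 + e * covK x 0 1.
Proof.
move=> e1; pose c : 'cV[R]_2 := \col_j (if j == 0 then 1 else e).
have c0 : c != 0.
  by apply/eqP => /matrixP/(_ 0 0); rewrite !mxE eqxx => /eqP; rewrite oner_eq0.
move: (covK_posdef fr normalized_data_gt0 c0).
move: (hnorm 0) (hnorm 1) (covK_sym x 0 1); move: (covK x) => K K00 K11 K01.
by rewrite !(mxE, sum_ord2) /= K00 K11 -K01; nra.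
Qed.

(** Since [beta_hat] does not depend on [t], it ties together the tangency points for all values of
    [t]. *)
Lemma beta_hat_orthant t beta s :
  lasso_estimate x y t beta -> orthant_interior s beta ->
  orthant_interior s (beta_hat x y).
Proof.
move=> est hs; have N0 := normalized_data_gt0.
have [lambda l0 hl] := lasso_stationary N0 est hs.
pose sigma : 'cV[R]_2 := \col_j (-1) ^+ s j.
(* The eigenvalue of [covK x] at [sigma]: [1 + covK x 0 1] for equal signs and [1 - covK x 0 1] for
   opposite ones. *)
pose kappa := 1 + (-1) ^+ s 0 * (-1) ^+ s 1 * covK x 0 1.
have k0 : 0 < kappa.
  by apply: covK_offdiag_bound; rewrite exprMn !sqrr_sign mulr1.
have eig : covK x *m sigma = kappa *: sigma.
  move: (hnorm 0) (hnorm 1) (covK_sym x 0 1); rewrite /kappa.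
  move: (covK x) => K K00 K11 K01; apply/matrixP => i j.
  rewrite ord1 !(mxE, sum_ord2).
  have [->|->] : i = 0 \/ i = 1.
    by case: i => -[|[|//]] ?; [left|right]; exact/val_inj.
  - by rewrite K00; case: (s 0) (s 1) => [] []; rewrite ?expr0 ?expr1; ring.
  - by rewrite K11 -K01; case: (s 0) (s 1) => [] []; rewrite ?expr0 ?expr1; ring.
have -> : beta_hat x y = beta + (lambda / kappa) *: sigma.
  (* After multiplication by the invertible [covK x], the claim is the stationarity equation [covb x
     y = covK x *m beta + lambda *: sigma]. *)
  apply: (can_inj (mulKmx (covK_unit fr N0))).
  rewrite mulKVmx ?(covK_unit fr N0) // mulmxDr -scalemxAr eig scalerA.
  rewrite divfK ?gt_eqF //; apply/eqP; rewrite addrC -subr_eq; apply/eqP.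
  by apply/matrixP => j k; rewrite ord1 hl !mxE.
move=> j; rewrite !mxE mulrDr mulrCA -expr2 sqrr_sign mulr1.
by rewrite ltr_pwDl // divr_ge0 // ltW.
Qed.

End NormalizedPlane.

Theorem proposition4p3 (R : realType) (N : nat)
    (x : 'I_N -> 'cV[R]_2) (y : 'I_N -> R)
    (hdata : data_set x y) (hnorm : normalized x) :
  (forall (t1 t2 : R) (beta1 beta2 : 'cV[R]_2) (s1 s2 : {ffun 'I_2 -> bool}),
      0 < t1 < t_hat x y -> 0 < t2 < t_hat x y ->
      lasso_estimate x y t1 beta1 -> lasso_estimate x y t2 beta2 ->
      edge_interior s1 t1 beta1 -> edge_interior s2 t2 beta2 ->
      s1 = s2)
  /\
  (exists s : {ffun 'I_2 -> bool},
    forall (t : R) (beta : 'cV[R]_2),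
      0 < t < t_hat x y -> lasso_estimate x y t beta ->
      beta 0 0 != 0 -> beta 1 0 != 0 ->
      orthant_interior s beta).
Proof.
have [_ fr] := hdata; split.
  move=> t1 t2 beta1 beta2 s1 s2 _ _ e1 e2 [_ h1] [_ h2].
  exact: orthant_interior_inj (beta_hat_orthant fr hnorm e1 h1)
                              (beta_hat_orthant fr hnorm e2 h2).
(* The witness is the sign pattern of [beta_hat]. Its value at a zero coordinate is harmless: once
   some such [beta] exists, [beta_hat] has no zero coordinate. *)
exists [ffun j => beta_hat x y j 0 < 0] => t beta _ est beta0 beta1.
have hs : orthant_interior [ffun j => beta j 0 < 0] beta.
  apply: orthant_interior_ltr0 => -[[|[|//]] ?].
  - by rewrite (_ : Ordinal _ = 0) //; exact/val_inj.
  - by rewrite (_ : Ordinal _ = 1) //; exact/val_inj.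
have hh := beta_hat_orthant fr hnorm est hs.
rewrite (_ : [ffun j => _] = [ffun j => beta j 0 < 0]) //.
apply: (orthant_interior_inj _ hh).
apply: orthant_interior_ltr0 => j; apply/eqP => z.
by have := hh j; rewrite z mulr0 ltxx.
Qed.
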